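(* Let $\mathbb F$ be a field and let $M$ be a $p \times q$ matrix over $\mathbb F$. Then there is one and only one $p\times q$ matrix $E$ over $\mathbb F$ in row reduced echelon form (RREF) that is row equivalent to $M$.
   Context: Row operations on a matrix are: scaling a row by a nonzero scalar, interchanging two rows, and subtracting a scalar multiple of one row from another row. Two matrices of the same size are row equivalent if one is obtained from the other by a finite sequence of row operations. A matrix $E$ is in row reduced echelon form (RREF) if: (i) in each row of $E$, the first nonzero entry from the left, if any, is a $1$ (this entry, and also its column, is called a pivot); (ii) in each pivot column, the pivot entry $1$ is the only nonzero entry; (iii) if a pivot entry $1$ is to the right of another pivot entry, it is also lower down; (iv) rows consisting entirely of zeros, if any, are at the bottom of the matrix. *)

(* Defs.v *)
From mathcomp Require Import all_boot all_order all_algebra.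
From Stdlib Require Import Relation_Operators.

Set Implicit Arguments.
Unset Strict Implicit.
Unset Printing Implicit Defensive.

Import GRing.Theory.
Local Open Scope ring_scope.

Definition row_scale (F : fieldType) (p q : nat) (i : 'I_p) (c : F)
    (A : 'M[F]_(p, q)) : 'M[F]_(p, q) :=
  \matrix_(k, l) if k == i then c * A i l else A k l.

Definition row_sub (F : fieldType) (p q : nat) (i j : 'I_p) (c : F)
    (A : 'M[F]_(p, q)) : 'M[F]_(p, q) :=
  \matrix_(k, l) if k == i then A i l - c * A j l else A k l.

Inductive row_op (F : fieldType) (p q : nat) (A : 'M[F]_(p, q)) :
    'M[F]_(p, q) -> Prop :=
  | RowScale (i : 'I_p) (c : F) : c != 0 -> row_op A (row_scale i c A)
  | RowSwap (i j : 'I_p) : row_op A (xrow i j A)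
  | RowSub (i j : 'I_p) (c : F) : i != j -> row_op A (row_sub i j c A).

Definition row_reachable (F : fieldType) (p q : nat) :
    'M[F]_(p, q) -> 'M[F]_(p, q) -> Prop :=
  clos_refl_trans _ (@row_op F p q).

(* "One is obtained from the other" does not fix a direction. *)
Definition row_equivalent (F : fieldType) (p q : nat) (A B : 'M[F]_(p, q)) :
    Prop :=
  row_reachable A B \/ row_reachable B A.

(* Position of the first nonzero entry of row i. Its being equal to 1 is not
   part of this predicate; it is the first clause of [rref]. *)
Definition pivot_at (F : fieldType) (p q : nat) (E : 'M[F]_(p, q))
    (i : 'I_p) (j : 'I_q) : Prop :=
  E i j != 0 /\ forall l : 'I_q, (l < j)%N -> E i l = 0.

Definition rref (F : fieldType) (p q : nat) (E : 'M[F]_(p, q)) : Prop :=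
  [/\ forall i j, pivot_at E i j -> E i j = 1,
      forall i j, pivot_at E i j -> forall k, k != i -> E k j = 0,
      forall i j i' j', pivot_at E i j -> pivot_at E i' j' ->
        (j < j')%N -> (i < i')%N
    & forall i k : 'I_p, row i E = 0 -> (i < k)%N -> row k E = 0].

(* Main.v *)
Require Import Defs.
From mathcomp Require Import all_boot all_order all_algebra.
From mathcomp Require Import perm.
From Stdlib Require Import Relation_Operators.

(** Existence is Gauss-Jordan elimination, one column at a time. Uniqueness:
    row operations preserve the linear relations between columns, and in an
    RREF matrix a column is a pivot column iff it is not a linear combination
    of the columns to its left. Hence if two row equivalent RREF matrices agree
    on the columns before [j], their columns [j] either satisfy the same linear
    relation, or are both the unit vector of the first row that vanishes
    before [j]. *)

Set Implicit Arguments.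
Unset Strict Implicit.
Unset Printing Implicit Defensive.

Import GRing.Theory.
Local Open Scope ring_scope.

(** * Row operations and linear relations between columns *)

Section RowOperations.

Variables (F : fieldType) (p : nat).

(** A row operation acts as a left multiplication, so it commutes with right multiplication by
    [X]. *)
Lemma row_op_mulmxr q r (A B : 'M[F]_(p, q)) (X : 'M[F]_(q, r)) :
  row_op A B -> row_op (A *m X) (B *m X).
Proof.
case=> [i c c_neq0|i j|i j c neq_ij].
- suff ->: row_scale i c A *m X = row_scale i c (A *m X) by constructor.
  apply/matrixP=> k l; rewrite !mxE; case: eqP => [->|/eqP/negPf nki].
    by rewrite mulr_sumr; apply: eq_bigr => m _; rewrite !mxE eqxx mulrA.
  by apply: eq_bigr => m _; rewrite !mxE nki.
- suff ->: xrow i j A *m X = xrow i j (A *m X) by constructor.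
  by rewrite !xrowE mulmxA.
- suff ->: Defs.row_sub i j c A *m X = Defs.row_sub i j c (A *m X) by constructor.
  apply/matrixP=> k l; rewrite !mxE; case: eqP => [->|/eqP/negPf nki].
    rewrite mulr_sumr -sumrB; apply: eq_bigr => m _.
    by rewrite !mxE eqxx mulrBl mulrA.
  by apply: eq_bigr => m _; rewrite !mxE nki.
Qed.

(** Row operations are invertible. Stating this as an equivalence lets null spaces be compared in
    both directions without proving reachability symmetric. *)
Lemma row_op_eq0 q (A B : 'M[F]_(p, q)) : row_op A B -> A = 0 <-> B = 0.
Proof.
case=> [i c c_neq0|i j|i j c neq_ij]; split=> [->|].
- by apply/matrixP=> k l; rewrite !mxE mulr0 if_same.
- move=> /matrixP A0; apply/matrixP=> k l; have:= A0 k l; rewrite !mxE.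
  by case: eqP => // -> /eqP; rewrite mulf_eq0 (negPf c_neq0) => /eqP.
- by apply/matrixP=> k l; rewrite !mxE.
- move=> /matrixP A0; apply/matrixP=> k l; have:= A0 (tperm i j k) l.
  by rewrite !mxE tpermK.
- by apply/matrixP=> k l; rewrite !mxE mulr0 subr0 if_same.
- move=> /matrixP A0; apply/matrixP=> k l.
  have:= A0 k l; have:= A0 j l; rewrite !mxE eq_sym (negPf neq_ij).
  by case: eqP => // -> ->; rewrite mulr0 subr0.
Qed.

Lemma row_reachable_ker q r (A B : 'M[F]_(p, q))
    (X : 'M[F]_(q, r)) :
  row_reachable A B -> A *m X = 0 <-> B *m X = 0.
Proof.
elim=> {A B} [A B opAB|A|A B C _ IH1 _ IH2] //.
- exact: row_op_eq0 (row_op_mulmxr X opAB).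
- exact: iff_trans IH1 IH2.
Qed.

Lemma row_equivalent_ker q r (A B : 'M[F]_(p, q))
    (X : 'M[F]_(q, r)) :
  row_equivalent A B -> A *m X = 0 <-> B *m X = 0.
Proof.
by case=> [AB|BA]; [|apply: iff_sym]; apply: row_reachable_ker.
Qed.

End RowOperations.

(** * Gauss-Jordan elimination *)

Section Existence.

Variables (F : fieldType) (p q : nat).
Implicit Types (A B : 'M[F]_(p, q)).

(** Rows are cleared one at a time by multiples of row [r]. The last clause protects the columns
    reduced earlier, where row [r] is zero. *)
Lemma row_reachable_clear_rows A (r : 'I_p) (j : 'I_q) (m : nat) :
  A r j = 1 -> (m <= p)%N ->
  exists B, [/\ row_reachable A B, row r B = row r A,
    forall k, B k j = if (k != r) && (k < m)%N then 0 else A k j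
    & forall l, A r l = 0 -> forall k, B k l = A k l].
Proof.
move=> Arj; elim: m => [_|m IH lt_mp].
  exists A; split=> //; first exact: rt_refl.
  by move=> k; rewrite andbF.
have [B [AB rB Bj Bl]] := IH (ltnW lt_mp).
(* The pivot row itself is skipped. *)
pose i := Ordinal lt_mp; have [eq_ir|neq_ir] := eqVneq i r.
  exists B; split=> // k; rewrite Bj [(k < m.+1)%N]ltnS (leq_eqVlt k).
  have [//|neq_kr] := eqVneq k r.
  suff /negPf ->: nat_of_ord k != m by [].
  by apply: contra neq_kr => /eqP km; rewrite -eq_ir; apply/eqP/ord_inj.
have Br l : B r l = A r l by move/rowP: rB => /(_ l); rewrite !mxE.
exists (Defs.row_sub i r (B i j) B); split.
- by apply: rt_trans AB _; apply/rt_step/RowSub.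
- by apply/rowP=> l; rewrite !mxE eq_sym (negPf neq_ir) Br.
- move=> k; rewrite !mxE; have [->|neq_ki] := eqVneq k i.
    by rewrite neq_ir ltnSn Br Arj mulr1 subrr.
  have /negPf neq_km : nat_of_ord k != m := neq_ki.
  by rewrite Bj [(k < m.+1)%N]ltnS (leq_eqVlt k) neq_km.
- move=> l Arl k; rewrite !mxE; case: eqP => [->|_]; last exact: Bl.
  by rewrite Br Arl mulr0 subr0 Bl.
Qed.

(** Swap the nonzero entry into row [r], scale it to 1, then clear the rest of the column. *)
Lemma row_reachable_unit_col A (i r : 'I_p) (j : 'I_q) :
  A i j != 0 ->
  exists B, [/\ row_reachable A B, forall k, B k j = (k == r)%:R
    & forall l, A i l = 0 -> A r l = 0 -> forall k, B k l = A k l].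
Proof.
move=> Aij; pose A1 := row_scale r (A i j)^-1 (xrow i r A).
have A1rj : A1 r j = 1 by rewrite !mxE eqxx tpermR mulVf.
have [B [A1B rB Bj Bl]] := row_reachable_clear_rows A1rj (leqnn p).
have AA1 : row_reachable A A1.
  apply: rt_trans (rt_step _ _ _ _ (RowSwap A i r)) _.
  by apply/rt_step/RowScale; rewrite invr_eq0.
exists B; split; first exact: rt_trans AA1 A1B.
  move=> k; rewrite Bj ltn_ord andbT.
  by have [->|] := eqVneq k r.
move=> l Ail Arl k; have A1l k' : A1 k' l = A k' l.
  rewrite !mxE; case: eqP => [->|_]; first by rewrite tpermR Ail Arl mulr0.
  by case: tpermP => [->|->|//]; rewrite Ail Arl.
by rewrite Bl A1l.
Qed.

(* The columns of [A] before [n] are in RREF, with [r] nonzero rows. *)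
Record rref_upto (n r : nat) A : Prop := RrefUpto {
  rref_upto_zero : forall (k : 'I_p) (l : 'I_q),
    (r <= k)%N -> (l < n)%N -> A k l = 0;
  rref_upto_pivot : forall k : 'I_p, (k < r)%N ->
    exists2 j : 'I_q, (j < n)%N & pivot_at A k j;
  rref_upto_unit : forall i (j : 'I_q), (j < n)%N -> pivot_at A i j ->
    forall k, A k j = (k == i)%:R;
  rref_upto_mono : forall i (j : 'I_q) i' (j' : 'I_q), (j' < n)%N ->
    pivot_at A i j -> pivot_at A i' j' -> (j < j')%N -> (i < i')%N }.

Lemma eq_pivot_at A B (i : 'I_p) (j : 'I_q) :
  (forall l : 'I_q, (l <= j)%N -> A i l = B i l) ->
  pivot_at A i j -> pivot_at B i j.
Proof.
move=> eqAB [Aij Ail]; split=> [|l lt_lj]; first by rewrite -eqAB.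
by rewrite -eqAB ?Ail // ltnW.
Qed.

Lemma rref_upto_nopivot n r A (j : 'I_q) :
  rref_upto n r A -> n = j -> (forall i : 'I_p, (r <= i)%N -> A i j = 0) ->
  rref_upto n.+1 r A.
Proof.
move=> [zeroA pivA unitA monoA] nj A0.
(* Column [j] holds no pivot: rows before [r] have theirs further left, and the other rows vanish
   there. *)
have npivA i (j' : 'I_q) : (j' < n.+1)%N -> pivot_at A i j' -> (j' < n)%N.
  rewrite ltnS leq_eqVlt => /orP[/eqP j'n|//] [Aij' Ail].
  case: (ltnP i r) => [/pivA[l lt_ln [Ail0 _]]|le_ri].
    by move: Ail0; rewrite Ail ?eqxx // j'n.
  by move: Aij'; rewrite (_ : j' = j) ?A0 ?eqxx //; apply: ord_inj; rewrite j'n.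
split.
- move=> k l le_rk; rewrite ltnS leq_eqVlt => /orP[/eqP ln|]; last exact: zeroA.
  by rewrite (_ : l = j) ?A0 //; apply: ord_inj; rewrite ln.
- by move=> k /pivA[l lt_ln pl]; exists l; first exact: ltnW.
- by move=> i l lt_ln pl; apply: unitA (npivA _ _ lt_ln pl) pl.
- move=> i l i' l' lt_ln' pl pl'; apply: monoA (npivA _ _ lt_ln' pl') pl pl'.
Qed.

(** Row [r] vanishes before column [j], so its new 1 is a pivot; pivots in earlier columns are those
    of [A]. *)
Lemma rref_upto_newpivot n A B (r : 'I_p) (j : 'I_q) :
  rref_upto n r A -> n = j -> (forall k, B k j = (k == r)%:R) ->
  (forall (l : 'I_q) k, (l < n)%N -> B k l = A k l) ->
  rref_upto n.+1 r.+1 B.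
Proof.
move=> [zeroA pivA unitA monoA] nj Bj Bl.
have pivBA i (l : 'I_q) : (l < n)%N -> pivot_at B i l -> pivot_at A i l.
  by move=> ltln; apply: eq_pivot_at => l' /leq_ltn_trans ltl'; rewrite Bl ?ltl'.
have pivAB i (l : 'I_q) : (l < n)%N -> pivot_at A i l -> pivot_at B i l.
  by move=> ltln; apply: eq_pivot_at => l' /leq_ltn_trans ltl'; rewrite Bl ?ltl'.
have colP (l : 'I_q) : (l < n.+1)%N -> (l < n)%N \/ l = j.
  rewrite ltnS leq_eqVlt => /orP[/eqP ln|]; [right|by left].
  by apply: ord_inj; rewrite ln.
have pivBj i : pivot_at B i j -> i = r.
  by case; rewrite Bj; case: (eqVneq i r) => //; rewrite eqxx.
split.
- move=> k l lt_rk /colP[lt_ln|->]; first by rewrite Bl // zeroA // ltnW.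
  by rewrite Bj; case: eqP lt_rk => // ->; rewrite ltnn.
- move=> k; rewrite ltnS leq_eqVlt => /orP[/eqP kr|/pivA[l lt_ln pl]].
    exists j; first by rewrite nj ltnSn.
    have -> : k = r by apply: ord_inj.
    split=> [|l lt_lj]; first by rewrite Bj eqxx oner_eq0.
    by rewrite Bl ?zeroA ?nj.
  by exists l; [exact: ltnW | exact: pivAB].
- move=> i l /colP[lt_ln pl k|-> /pivBj-> //].
  by rewrite Bl // (unitA i) //; apply: pivBA.
- move=> i l i' l' /colP[lt_ln'|->] pl pl' lt_ll'.
    have lt_ln := ltn_trans lt_ll' lt_ln'.
    exact: monoA lt_ln' (pivBA _ _ lt_ln pl) (pivBA _ _ lt_ln' pl') lt_ll'.
  rewrite (pivBj _ pl') ltnNge; apply/negP=> le_ri.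
  have lt_ln : (l < n)%N by rewrite nj.
  by case: pl => + _; rewrite Bl // zeroA ?eqxx.
Qed.

Lemma rref_upto_exists A n : (n <= q)%N ->
  exists B r, row_reachable A B /\ rref_upto n r B.
Proof.
elim: n => [_|n IH lt_nq].
  by exists A, 0%N; split; [exact: rt_refl | split].
have [B [r [AB rrefB]]] := IH (ltnW lt_nq); pose j := Ordinal lt_nq.
(* Rows before [r] already have pivots, so a new one is sought only from row [r] on. *)
have [/existsP[i /andP[le_ri Bij]]|/existsPn B0] :=
    boolP [exists i : 'I_p, (r <= i)%N && (B i j != 0)].
  pose r' := Ordinal (leq_ltn_trans le_ri (ltn_ord i)).
  have [C [BC Cj Cl]] := row_reachable_unit_col r' Bij.
  exists C, r.+1; split; first exact: rt_trans AB BC.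
  apply: (@rref_upto_newpivot n B C r' j) => // l k lt_ln.
  by rewrite Cl // (rref_upto_zero rrefB).
exists B, r; split=> //; apply: (rref_upto_nopivot (j := j)) => // i le_ri.
by apply/eqP; move: (B0 i); rewrite le_ri negbK.
Qed.

Lemma rref_upto_full r A : rref_upto q r A -> rref A.
Proof.
case=> zeroA pivA unitA monoA; split.
- by move=> i j piv; rewrite (unitA i) ?eqxx.
- by move=> i j piv k /negPf nki; rewrite (unitA i) // nki.
- by move=> i j i' j'; apply: monoA.
- move=> i k /rowP Ai lt_ik; apply/rowP=> l; rewrite !mxE zeroA //.
  (* A zero row has no pivot, so its index is at least [r], and so is that of any row below it. *)
  apply: leq_trans (ltnW lt_ik); rewrite leqNgt; apply/negP=> /pivA[j _ [+ _]].
  by have:= Ai j; rewrite !mxE => ->; rewrite eqxx.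
Qed.

End Existence.

(** * An RREF matrix is determined by its null space *)

Section Uniqueness.

Variables (F : fieldType) (p q : nat).
Implicit Types (E A : 'M[F]_(p, q)).

(** Boolean form of [pivot_at], for filtering sums and deciding cases. *)
Definition is_pivot E (i : 'I_p) (j : 'I_q) : bool :=
  (E i j != 0) && [forall l : 'I_q, (l < j)%N ==> (E i l == 0)].

Lemma is_pivotP E i j : reflect (pivot_at E i j) (is_pivot E i j).
Proof.
apply: (iffP andP) => [[Eij /forallP Eil]|[Eij Eil]]; split=> //.
  by move=> l lt_lj; apply/eqP; move: (Eil l); rewrite lt_lj.
by apply/forallP=> l; apply/implyP=> /Eil ->.
Qed.

Lemma pivot_exists E i j : E i j != 0 ->
  exists2 l : 'I_q, (l <= j)%N & pivot_at E i l.
Proof.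
move=> Eij; case: (arg_minnP (@nat_of_ord q) (i0 := j) (P := fun l => E i l != 0) Eij).
move=> l Eil min_l; exists l; first exact: min_l.
split=> // l' lt_l'l; apply/eqP; apply: contraTT lt_l'l => /min_l.
by rewrite -leqNgt.
Qed.

Lemma pivot_at_uniq E i j j' : pivot_at E i j -> pivot_at E i j' -> j = j'.
Proof.
move=> [Ej Ejl] [Ej' Ejl']; case: (ltngtP j j') => [/Ejl' E0|/Ejl E0|/ord_inj //].
  by rewrite E0 eqxx in Ej.
by rewrite E0 eqxx in Ej'.
Qed.

Lemma rref_pivot_col E i j : rref E -> pivot_at E i j ->
  forall k, E k j = (k == i)%:R.
Proof.
move=> [one zero _ _] piv k.
by have [->|neq_ki] := eqVneq k i; [exact: one | exact: zero neq_ki].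
Qed.

(** A row that is nonzero in column [j] has its pivot strictly further left, and that pivot's column
    is a unit vector. *)
Lemma rref_nonpivot_col E (j : 'I_q) :
    rref E -> (forall i, ~ pivot_at E i j) ->
  exists2 y : 'cV[F]_q, (forall l : 'I_q, (j <= l)%N -> y l 0 = 0)
    & E *m y = col j E.
Proof.
move=> rrefE npiv.
(* The entry of [col j E] in row [i] is the coefficient of the pivot column
   of row [i]. *)
exists (\col_l if (l < j)%N then \sum_(i | is_pivot E i l) E i j else 0).
  by move=> l le_jl; rewrite mxE ltnNge le_jl.
apply/colP=> k; rewrite !mxE.
have [Ekj|Ekj] := eqVneq (E k j) 0.
  rewrite Ekj big1 // => l _; rewrite mxE; case: ifP => _; last by rewrite mulr0.
  rewrite mulr_sumr big1 // => i /is_pivotP piv.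
  rewrite (rref_pivot_col rrefE piv); case: eqP => [<-|_].
    by rewrite Ekj mulr0.
  by rewrite mul0r.
have [l0 le_l0j piv0] := pivot_exists Ekj.
have lt_l0j : (l0 < j)%N.
  rewrite ltn_neqAle le_l0j andbT; apply/negP=> /eqP/ord_inj eq_l0j.
  by apply: (npiv k); rewrite -eq_l0j.
have col0 := rref_pivot_col rrefE piv0.
(* In row [k], only the pivot column [l0] of that row contributes. *)
rewrite (bigD1 l0) //= [X in _ + X]big1 => [|l neq_l].
  rewrite addr0 mxE lt_l0j col0 eqxx mul1r (bigD1 k) /=; last exact/is_pivotP.
  rewrite big1 ?addr0 // => i /andP[/is_pivotP[+ _] neq_ik].
  by rewrite col0 (negPf neq_ik) eqxx.
rewrite mxE; case: ifP => _; last by rewrite mulr0.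
rewrite mulr_sumr big1 // => i /is_pivotP piv.
rewrite (rref_pivot_col rrefE piv); case: eqP => [eq_ki|_]; last by rewrite mul0r.
by rewrite -eq_ki in piv; rewrite (pivot_at_uniq piv piv0) eqxx in neq_l.
Qed.

(** Otherwise column [j] would be a combination of earlier columns in [E'], hence in [E], where row
    [i] vanishes before its nonzero entry in column [j]. *)
Lemma rref_pivot_transfer E E' i (j : 'I_q) :
    rref E -> rref E' ->
    (forall y : 'cV[F]_q, E' *m y = col j E' -> E *m y = col j E) ->
  pivot_at E i j -> exists i', pivot_at E' i' j.
Proof.
move=> rrefE rrefE' rel [Eij Eil].
have [/existsP[i' /is_pivotP]|/existsPn npiv] := boolP [exists i', is_pivot E' i' j].
  by exists i'.
have [|y y0 /rel /colP/(_ i)] := @rref_nonpivot_col E' j rrefE'.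
  by move=> i' /is_pivotP; apply/negP.
rewrite !mxE big1 => [E0|l _]; first by rewrite -E0 eqxx in Eij.
by have [/y0 ->|/Eil ->] := leqP j l; rewrite ?mulr0 ?mul0r.
Qed.

(** If [i < i'], row [i] of [E'] is nonzero, as row [i'] below it is. Its pivot cannot be left of
    [j], where it agrees with [E]; nor right of [j], by monotonicity; nor at [j], whose column is
    the unit vector of [i']. *)
Lemma rref_pivot_row_le E E' i i' (j : 'I_q) :
    rref E -> rref E' ->
    (forall (l : 'I_q) k, (l < j)%N -> E k l = E' k l) ->
  pivot_at E i j -> pivot_at E' i' j -> (i' <= i)%N.
Proof.
move=> rrefE rrefE' eqEE' piv piv'; rewrite leqNgt; apply/negP=> lt_ii'.
have [_ _ mono zero] := rrefE'.
have [E'i|] := eqVneq (row i E') 0.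
  have /rowP/(_ j) := zero _ _ E'i lt_ii'; rewrite !mxE => E0.
  by case: piv' => + _; rewrite E0 eqxx.
case/rV0Pn=> l0; rewrite mxE => /pivot_exists[l _ pivl].
have [lt_lj|lt_jl|/ord_inj eq_lj] := ltngtP l j.
- by case: pivl => + _; rewrite -eqEE' // (proj2 piv) ?eqxx.
- by have:= mono _ _ _ _ piv' pivl lt_jl; rewrite ltnNge (ltnW lt_ii').
- case: pivl => + _; rewrite eq_lj (rref_pivot_col rrefE' piv').
  by case: (eqVneq i i') lt_ii' => [->|_]; rewrite ?ltnn ?eqxx.
Qed.

Lemma rref_ker_inj E E' :
    rref E -> rref E' ->
    (forall x : 'cV[F]_q, E *m x = 0 <-> E' *m x = 0) ->
  E = E'.
Proof.
move=> rrefE rrefE' ker.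
(* Expressing column [j] through [y] means that [y] minus the [j]-th unit vector is in the null
   space. *)
have rel (j : 'I_q) (y : 'cV[F]_q) : E *m y = col j E <-> E' *m y = col j E'.
  have:= ker (y - delta_mx j 0); rewrite !mulmxBr -!colE => kerj.
  by split=> [eq|eq]; apply/eqP; rewrite -subr_eq0; apply/eqP/kerj; rewrite eq subrr.
suff colEE' n (j : 'I_q) : (j < n)%N -> forall k, E k j = E' k j.
  by apply/matrixP=> k j; apply: (colEE' q).
elim: n j => // n IH j le_jn.
have {IH}IH (l : 'I_q) k : (l < j)%N -> E k l = E' k l.
  by move=> lt_lj; apply: IH; apply: leq_trans lt_lj le_jn.
have [/existsP[i /is_pivotP piv] k|/existsPn npiv k] :=
    boolP [exists i, is_pivot E i j].
  have [i' piv'] := rref_pivot_transfer rrefE rrefE' (fun y => proj2 (rel j y)) piv.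
  rewrite (rref_pivot_col rrefE piv) (rref_pivot_col rrefE' piv').
  suff -> : i = i' by [].
  apply: ord_inj; apply/eqP; rewrite eqn_leq; apply/andP; split.
    apply: (rref_pivot_row_le rrefE' rrefE) piv' piv => l k' lt_lj.
    by rewrite IH.
  exact: (rref_pivot_row_le rrefE rrefE') piv piv'.
(* The same [y] yields column [j] in both matrices, and it is supported on columns where they
   agree. *)
have [|y y0 yE] := @rref_nonpivot_col E j rrefE.
  by move=> i /is_pivotP; apply/negP.
have /colP/(_ k) := yE; have /rel/colP/(_ k) := yE; rewrite !mxE => <- <-.
apply: eq_bigr => l _.
by have [/y0 ->|/IH ->] := leqP j l; rewrite ?mulr0.
Qed.

End Uniqueness.

Theorem theorem1 (F : fieldType) (p q : nat) (M : 'M[F]_(p, q)) :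
  exists! E : 'M[F]_(p, q), rref E /\ row_equivalent E M.
Proof.
have [E [r [ME /rref_upto_full rrefE]]] := rref_upto_exists M (leqnn q).
exists E; split; first by split; [|right].
move=> E' [rrefE' E'M]; apply: rref_ker_inj => // x.
(* Both null spaces equal that of [M]. *)
exact: iff_trans (iff_sym (row_reachable_ker x ME)) (iff_sym (row_equivalent_ker x E'M)).
Qed.
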